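(* Let $(X,d_X)$ and $(Y,d_Y)$ be metric spaces and $f:X\to Y$ a nonconstant continuous function. If for all $p\in X$ and $r>0$ the open ball $B(p,r)$ is path-connected, then there exists $\beta>0$ such that the delta-epsilon numbers $\delta(p,\epsilon)$ are well defined on the set $X\times(0,\beta)$; that is, for every $(p,\epsilon)\in X\times(0,\beta)$ the set $f^{-1}(S[f(p),\epsilon])$ is nonempty and $\delta(p,\epsilon)=\mathrm{dist}(p,f^{-1}(S[f(p),\epsilon]))$ is a (positive) delta-epsilon number for $f$ at $p$.
   Context: $S[y_0,\epsilon]=\{y\in Y: d_Y(y_0,y)=\epsilon\}$; $\mathrm{dist}(p,A)=\inf\{d_X(p,z): z\in A\}$ for nonempty $A\subset X$; $B(p,r)=\{z\in X: d_X(z,p)<r\}$. A positive number $\delta$ is a delta-epsilon number for $f$ at $p$ (for the given $\epsilon$) if for all $z\in X$, $d_X(z,p)<\delta$ implies $d_Y(f(z),f(p))<\epsilon$. *)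

(* Defs.v *)
(* MathComp-Analysis; a metric space is a [metricType R] for an arbitrary
   [R : realType], with distance [mdist] and open balls [ball p r]. *)
From HB Require Import structures.
From mathcomp Require Import all_boot all_order all_algebra.
From mathcomp Require Import all_classical all_reals all_analysis.

Set Implicit Arguments.
Unset Strict Implicit.
Unset Printing Implicit Defensive.

Import Order.TTheory GRing.Theory Num.Theory.
Import numFieldNormedType.Exports.

Local Open Scope classical_set_scope.
Local Open Scope ring_scope.

Definition mdist_sphere (R : realType) (Y : metricType R) (y0 : Y) (e : R) :
    set Y :=
  [set y | mdist y0 y = e].

(* [inf] is the real infimum, so this is only meaningful for nonempty [A]
   (it is 0 when [A] is empty). *)
Definition mdist_set (R : realType) (X : metricType R) (p : X) (A : set X) : R :=
  inf [set mdist p z | z in A].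

Definition is_delta_epsilon (R : realType) (X Y : metricType R) (f : X -> Y)
    (p : X) (e d : R) : Prop :=
  0 < d /\ forall z : X, mdist z p < d -> mdist (f z) (f p) < e.

Definition delta_epsilon (R : realType) (X Y : metricType R) (f : X -> Y)
    (p : X) (e : R) : R :=
  mdist_set p (f @^-1` mdist_sphere (f p) e).

(* A path is a map on R of which only the restriction to [0, 1] matters:
   continuity is for the subspace topology of [0, 1]. *)
Definition path_connected (R : realType) (X : metricType R) (A : set X) : Prop :=
  forall x y : X, A x -> A y ->
  exists g : R -> X,
    [/\ {within `[0, 1], continuous g}, g 0 = x, g 1 = y &
        forall t : R, `[0, 1]%classic t -> A (g t)].

Definition nonconstant (X Y : Type) (f : X -> Y) : Prop :=
  exists x y : X, f x <> f y.

(* Main.v *)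
Require Import Defs.
From HB Require Import structures.
From mathcomp Require Import all_boot all_order all_algebra.
From mathcomp Require Import all_classical all_reals all_analysis.
From mathcomp Require Import lra.

(** If [f a] and [f b] are at distance [D > 0], the triangle inequality shows
    that every point of [Y] is at distance at least [D / 2] from [f a] or from
    [f b]; so [beta = D / 2] makes [f] escape the open ball of radius [e < beta]
    around [f p], whatever [p]. Along a path from [p] to a point [z] with
    [e <= mdist (f p) (f z)] the distance to [f p] varies continuously from [0]
    to at least [e], hence equals [e] somewhere: this is
    [path_connected_sphere_crossing]. Applied in a ball around [p] large enough
    to contain [z], it makes the preimage of the sphere nonempty. Applied in the
    ball whose radius is the distance from [p] to that preimage, it shows that no
    point of this ball is sent at distance [e] or more from [f p], since a
    crossing point would lie in the preimage and yet be too close to [p]. That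
    the distance is positive is the continuity of [f] at [p]. *)

Set Implicit Arguments.
Unset Strict Implicit.
Unset Printing Implicit Defensive.

Import Order.TTheory GRing.Theory Num.Theory.
Import numFieldNormedType.Exports.

Local Open Scope classical_set_scope.
Local Open Scope ring_scope.

Lemma continuous_mdistl (R : realType) (Y : metricType R) (y0 : Y) :
  continuous (fun y => mdist y0 y : R).
Proof.
move=> y; apply/cvgrPdist_lt => eps eps0.
near=> z.
have yz : mdist y z < eps.
  by near: z; move: (nbhsx_ballx y eps eps0); rewrite ballEmdist.
have h1 := metric_triangle y0 y z.
have h2 := metric_triangle y0 z y.
rewrite (metric_sym z y) in h2.
by rewrite ltr_norml; lra.
Unshelve. all: by end_near. Qed.

(** A path in [A] from [x] to a point whose image is at distance at least [e]
    from [f x] meets the preimage of the sphere of radius [e] around [f x]. *)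
Lemma path_connected_sphere_crossing (R : realType) (X Y : metricType R)
    (f : X -> Y) (A : set X) (x z : X) (e : R) :
  continuous f -> path_connected A -> A x -> A z ->
  0 <= e -> e <= mdist (f x) (f z) ->
  exists2 w, A w & mdist (f x) (f w) = e.
Proof.
move=> cf pA Ax Az e0 ez.
have [g [cg g0 g1 gA]] := pA x z Ax Az.
have ch : {within `[0, 1], continuous (fun t => mdist (f x) (f (g t)) : R)}.
  move=> t; apply: (@continuous_comp _ _ _ (g : subspace `[0, 1] -> X)
    (fun u => mdist (f x) (f u) : R)); first exact: cg.
  by apply: (@continuous_comp _ _ _ f); [exact: cf|exact: continuous_mdistl].
have [|t t01 <-] := IVT ler01 ch (v := e).
  by rewrite g0 g1 mdistxx min_l ?max_r ?mdist_ge0 ?e0.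
by exists (g t) => //; exact: gA.
Qed.

Lemma nonconstant_far_image (R : realType) (X Y : metricType R) (f : X -> Y) :
  nonconstant f ->
  exists2 beta : R, 0 < beta & forall y, exists z, beta <= mdist y (f z).
Proof.
move=> [a [b fab]].
have D0 : 0 < mdist (f a) (f b) by rewrite mdist_gt0; apply/eqP.
exists (mdist (f a) (f b) / 2); first by lra.
move=> y; have := metric_triangle (f a) y (f b).
rewrite (metric_sym (f a) y) => tri.
have [ya|ya] := leP (mdist (f a) (f b) / 2) (mdist y (f a)); first by exists a.
by exists b; lra.
Qed.

Section distance_to_set.
Context (R : realType) (X : metricType R) (p : X) (A : set X).

Lemma mdist_set_le z : A z -> mdist_set p A <= mdist p z.
Proof.
move=> Az; apply: ge_inf; last by exists z.
by exists 0 => _ [w _ <-]; exact: mdist_ge0.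
Qed.

Lemma le_mdist_set d :
  A !=set0 -> (forall z, A z -> d <= mdist p z) -> d <= mdist_set p A.
Proof.
move=> [a Aa] dA; apply: lb_le_inf; first by exists (mdist p a), a.
by move=> _ [w Aw <-]; exact: dA.
Qed.

End distance_to_set.

Lemma delta_epsilon_gt0 (R : realType) (X Y : metricType R) (f : X -> Y)
    (p : X) (e : R) :
  {for p, continuous f} -> 0 < e ->
  f @^-1` mdist_sphere (f p) e !=set0 -> 0 < delta_epsilon f p e.
Proof.
move=> cf e0 ne.
have /cf/nbhs_ballP[d /= d0 pd] := nbhsx_ballx (f p) e e0.
apply: (lt_le_trans d0); apply: le_mdist_set => // z fz.
rewrite leNgt; apply/negP => pz.
have : ball (f p) e (f z) by apply: pd; rewrite ballEmdist.
by rewrite ballEmdist/= fz ltxx.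
Qed.

Theorem corollary3 (R : realType) (X Y : metricType R) (f : X -> Y)
    (f_nonconstant : nonconstant f)
    (f_continuous : continuous f)
    (ball_path_connected :
       forall (p : X) (r : R), 0 < r -> path_connected (ball p r)) :
  exists2 beta : R, 0 < beta &
    forall (p : X) (e : R), 0 < e -> e < beta ->
      f @^-1` mdist_sphere (f p) e !=set0 /\
      is_delta_epsilon f p e (delta_epsilon f p e).
Proof.
have [beta beta0 far] := nonconstant_far_image f_nonconstant.
exists beta => // p e e0 eb.
have ne : f @^-1` mdist_sphere (f p) e !=set0.
  have [z pz] := far (f p).
  have r0 : 0 < mdist p z + 1 by rewrite ltr_wpDl ?mdist_ge0.
  have zp : ball p (mdist p z + 1) z by rewrite ballEmdist/= ltrDl.
  have [w _ fw] := path_connected_sphere_crossing f_continuous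
    (ball_path_connected p _ r0) (ballxx p r0) zp (ltW e0)
    (le_trans (ltW eb) pz).
  by exists w.
split=> //.
have d0 := delta_epsilon_gt0 (f_continuous p) e0 ne.
split=> // z; rewrite (metric_sym z) (metric_sym (f z)) => pz.
have zp : ball p (delta_epsilon f p e) z by rewrite ballEmdist.
rewrite ltNge; apply/negP => ez.
have [w] := path_connected_sphere_crossing f_continuous
  (ball_path_connected p _ d0) (ballxx p d0) zp (ltW e0) ez.
rewrite ballEmdist/= => pw fw.
have := mdist_set_le p (A := f @^-1` mdist_sphere (f p) e) fw.
by rewrite leNgt; move/negP; apply.
Qed.
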